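(* Let $A\in\mathbb{R}^{m\times n}$ with $m<n$ and $\operatorname{rank}(A)=m$, let $b\in\mathbb{R}^m$, $p>0$ and $0<q\le 1$. If $x^*$ is the solution of $$\min_{x\in\mathbb{R}^n}\|x\|_{h_{p,q}}\quad\text{s.t. }Ax=b,$$ then $x^*$ satisfies the equation $$x^*=F(x^* )A^T\left(AF(x^* )A^T\right)^{-1}b .$$
   Context: For $p>0$ and $0<q\le 1$ let $h_{p,q}(t)=\log\left(1+|t|^q/p\right)$ for $t\in\mathbb{R}$, and for $x\in\mathbb{R}^n$ let $\|x\|_{h_{p,q}}=\sum_{i=1}^n h_{p,q}(x_i)$. For $x\in\mathbb{R}^n$, $F(x)\in\mathbb{R}^{n\times n}$ is the diagonal matrix with entries $F(x)_{i,i}=\dfrac{|x_i|^{2-q}\left(p+|x_i|^q\right)}{q}$.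
   Formalization: The matrix AF(x* )A^T is assumed invertible; this does not follow from the other hypotheses (for A=[1 0 3; 0 1 3], b=(1,0) the unique solution is x*=(1,0,0) and AF(x* )A^T is singular), and without it the inverse in the equation is undefined. *)

(* Defs.v *)
From HB Require Import structures.
From mathcomp Require Import all_boot all_order all_algebra.
From mathcomp Require Import all_classical all_reals all_analysis.

Set Implicit Arguments.
Unset Strict Implicit.
Unset Printing Implicit Defensive.

Import Order.TTheory GRing.Theory Num.Theory.
Local Open Scope ring_scope.

(* Every real power below has exponent q or 2 - q, which is positive when
   0 < q <= 1; powR then gives 0 `^ q = 0 and 0 `^ (2 - q) = 0, as intended. *)

Definition hpq (R : realType) (p q t : R) : R := ln (1 + `|t| `^ q / p).

Definition hpq_penalty (R : realType) (p q : R) (n : nat) (x : 'cV[R]_n) : R :=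
  \sum_(i < n) hpq p q (x i 0).

Definition Fmx (R : realType) (p q : R) (n : nat) (x : 'cV[R]_n) : 'M[R]_n :=
  diag_mx (\row_(i < n)
    (`|x i 0| `^ (2 - q) * (p + `|x i 0| `^ q) / q)).

(* Global minimizers; uniqueness is not required. *)
Definition is_solution (R : realType) (p q : R) (m n : nat)
    (A : 'M[R]_(m, n)) (b : 'cV[R]_m) (x : 'cV[R]_n) : Prop :=
  A *m x = b /\
  (forall y : 'cV[R]_n, A *m y = b ->
     hpq_penalty p q x <= hpq_penalty p q y).

(* Main.v *)
Require Import Defs.
From HB Require Import structures.
From mathcomp Require Import all_boot all_order all_algebra.
From mathcomp Require Import all_classical all_reals all_analysis.
From mathcomp Require Import ring lra.

(** By Young's inequality and [ln (1 + u) <= u], for [x <> 0] the penalty [h]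
    lies below the quadratic [h(x) + (y^2 - x^2) / (2 F(x))] tangent to it at
    [x].  The right-hand side [z] of the claim minimises this majorant, i.e. the
    weighted norm [sum y_i^2 / F_ii(x)] over the support of [x] subject to
    [A y = b]; by Pythagoras the majorant drops by [sum (x_i - z_i)^2 / (2 F_ii)]
    from [x] to [z], which minimality of [x] forces to vanish. *)

Set Implicit Arguments.
Unset Strict Implicit.
Unset Printing Implicit Defensive.

Import Order.TTheory GRing.Theory Num.Theory.
Local Open Scope ring_scope.

Definition Fentry (R : realType) (p q t : R) : R :=
  `|t| `^ (2 - q) * (p + `|t| `^ q) / q.

Lemma FmxE (R : realType) (p q : R) (n : nat) (x : 'cV[R]_n) :
  Fmx p q x = diag_mx (\row_(i < n) Fentry p q (x i 0)).
Proof. by []. Qed.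

Lemma Fentry0 (R : realType) (p q : R) : q < 2 -> Fentry p q 0 = 0.
Proof.
by move=> q2; rewrite /Fentry normr0 powR0 ?mul0r// subr_eq0 gt_eqF.
Qed.

Lemma Fentry_gt0 (R : realType) (p q t : R) :
  0 < p -> 0 < q -> t != 0 -> 0 < Fentry p q t.
Proof.
move=> p0 q0 t0; rewrite /Fentry divr_gt0// mulr_gt0 ?powR_gt0 ?normr_gt0//.
by rewrite ltr_wpDr ?powR_ge0.
Qed.

(** Young's inequality with the conjugate exponents [2 / q] and [2 / (2 - q)], chosen so that both
    powers become squares. *)
Lemma powR_young (R : realType) (q x y : R) : 0 < q -> q < 2 ->
  `|y| `^ q * `|x| `^ (2 - q) <= q / 2 * y ^+ 2 + (2 - q) / 2 * x ^+ 2.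
Proof.
move=> q0 q2; have q2' : 0 < 2 - q by rewrite subr_gt0.
have := @conjugate_powR R (`|y| `^ q) (`|x| `^ (2 - q)) (2 / q) (2 / (2 - q))
  (powR_ge0 _ _) (powR_ge0 _ _) (divr_gt0 (ltr0Sn _ 1) q0)
  (divr_gt0 (ltr0Sn _ 1) q2').
have -> : (2 / q)^-1 + (2 / (2 - q))^-1 = 1.
  by field; rewrite !gt_eqF.
rewrite -!powRrM => /(_ erefl).
have -> : q * (2 / q) = 2%:R by field; rewrite gt_eqF.
have -> : (2 - q) * (2 / (2 - q)) = 2%:R by field; rewrite gt_eqF.
rewrite !powR_mulrn// !real_normK ?num_real// !invf_div.
by rewrite ![_ ^+ 2 * _]mulrC.
Qed.

Lemma hpq_majorant (R : realType) (p q x y : R) :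
  0 < p -> 0 < q -> q < 2 -> x != 0 ->
  hpq p q y - hpq p q x <= (y ^+ 2 - x ^+ 2) / (2 * Fentry p q x).
Proof.
move=> p0 q0 q2 x0; rewrite /hpq /Fentry.
have := powR_young x y q0 q2.
have : `|x| `^ q * `|x| `^ (2 - q) = x ^+ 2.
  rewrite -powRD; last by rewrite normr_eq0 x0 implybT.
  by rewrite addrC subrK powR_mulrn// real_normK ?num_real.
have : 0 < `|x| `^ (2 - q) by rewrite powR_gt0 ?normr_gt0.
move: (powR_ge0 `|x| q) (powR_ge0 `|y| q).
move: (`|x| `^ q) (`|y| `^ q) (`|x| `^ (2 - q)) => X Y W X0 Y0 W0 XW YW.
have pX : 0 < p + X by rewrite ltr_wpDr.
have pY : 0 < p + Y by rewrite ltr_wpDr.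
rewrite -ln_div ?posrE ?ltr_wpDr ?divr_ge0 ?(ltW p0)//.
have -> : (1 + Y / p) / (1 + X / p) = 1 + (Y - X) / (p + X).
  by field; rewrite !gt_eqF.
(* [ln (1 + u) <= u] needs [-1 < u], which here amounts to [0 < p + Y]. *)
apply: (@le_trans _ _ ((Y - X) / (p + X))).
  by apply: le_ln1Dx; rewrite ltr_pdivlMr// mulN1r; lra.
have -> : (y ^+ 2 - x ^+ 2) / (2 * (W * (p + X) / q)) =
    (q / 2 * (y ^+ 2 - x ^+ 2)) / W / (p + X).
  by field; rewrite !gt_eqF.
rewrite ler_pM2r ?invr_gt0// ler_pdivlMr//.
(* Subtracting [X * W = x ^+ 2] from Young's bound leaves exactly the goal. *)
by move: YW; rewrite -XW; nra.
Qed.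

(* [z] is written [F * w]: the cross term of the quadratic majorant is then
   linear in [x - F * w] even where [F] vanishes. *)
Lemma hpq_majorant_split (R : realType) (p q x w : R) :
  0 < p -> 0 < q -> q < 2 ->
  let z := Fentry p q x * w in
  (x - z) ^+ 2 / (2 * Fentry p q x) <=
    hpq p q x - hpq p q z - w * (x - z).
Proof.
move=> p0 q0 q2 /=; have [->|x0] := eqVneq x 0.
  (* No tangent quadratic exists at 0, but there [z = x = 0] and both sides vanish. *)
  by rewrite Fentry0// mul0r !subrr !mulr0 subr0 expr0n mul0r.
have F0 := Fentry_gt0 p0 q0 x0.
have := hpq_majorant (Fentry p q x * w) p0 q0 q2 x0.
move: (hpq _ _ _) (hpq _ _ _) => hz hx.
move: (Fentry p q x) F0 => F F0.
have -> : ((F * w) ^+ 2 - x ^+ 2) / (2 * F) =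
   - ((x - F * w) ^+ 2 / (2 * F)) - w * (x - F * w).
  by field; rewrite gt_eqF.
lra.
Qed.

Theorem theorem6 (R : realType) (m n : nat) (A : 'M[R]_(m, n)) (b : 'cV[R]_m)
    (p q : R) (xs : 'cV[R]_n)
    (hmn : (m < n)%N) (hrank : \rank A = m)
    (hp : 0 < p) (hq0 : 0 < q) (hq1 : q <= 1)
    (hsol : is_solution p q A b xs)
    (hinv : A *m Fmx p q xs *m A^T \in unitmx) :
  xs = Fmx p q xs *m A^T *m invmx (A *m Fmx p q xs *m A^T) *m b.
Proof.
have q2 : q < 2 by lra.
(* The Lagrange multiplier of the weighted least-squares problem; [A^T *m y] supplies the [w] of
   [hpq_majorant_split]. *)
set y := invmx (A *m Fmx p q xs *m A^T) *m b.
set z := RHS; case: hsol => Axs xs_min.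
have zE : z = Fmx p q xs *m (A^T *m y) by rewrite /z /y !mulmxA.
have Az : A *m z = b.
  by rewrite zE !mulmxA mulmxV// mul1mx.
have ziE i : z i 0 = Fentry p q (xs i 0) * (A^T *m y) i 0.
  by rewrite zE FmxE mul_diag_mx !mxE.
(* [xs] and [z] are both feasible, so [xs - z] lies in the kernel of [A], orthogonal to the range of
   [A^T]. *)
have orth : \sum_i (A^T *m y) i 0 * (xs i 0 - z i 0) = 0.
  have : (A^T *m y)^T *m (xs - z) = 0.
    by rewrite trmx_mul trmxK -mulmxA mulmxBr Axs Az subrr mulmx0.
  move=> /matrixP/(_ 0 0); rewrite mxE [RHS]mxE; apply: etrans.
  apply: eq_bigr => i _.
  by rewrite [_^T _ _]mxE [(xs - z) _ _]mxE [(- z) _ _]mxE.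
pose E i := (xs i 0 - z i 0) ^+ 2 / (2 * Fentry p q (xs i 0)).
have F_ge0 i : 0 <= Fentry p q (xs i 0).
  by have [->|/(Fentry_gt0 hp hq0)/ltW//] := eqVneq (xs i 0) 0; rewrite Fentry0.
have E_ge0 i : true -> 0 <= E i.
  by move=> _; rewrite divr_ge0 ?sqr_ge0// mulr_ge0.
have E_sum : \sum_i E i = 0.
  apply/eqP; rewrite eq_le sumr_ge0// andbT.
  apply: (@le_trans _ _ (\sum_i (hpq p q (xs i 0) - hpq p q (z i 0)
      - (A^T *m y) i 0 * (xs i 0 - z i 0)))).
    by apply: ler_sum => i _; rewrite /E ziE; exact: hpq_majorant_split.
  (* The linear terms cancel, leaving the penalty of [xs] minus that of the feasible [z]. *)
  by rewrite !sumrB orth subr0 subr_le0 xs_min.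
apply/matrixP => i j; rewrite ord1.
(* Off the support [E i] is a division by zero and carries no information, but the factor [F]
   already forces [z i 0 = 0]. *)
have [xi0|xi0] := eqVneq (xs i 0) 0; first by rewrite ziE xi0 Fentry0// mul0r.
have /eqP := @psumr_eq0P _ _ _ _ E_ge0 E_sum i erefl.
have F2 : 2 * Fentry p q (xs i 0) != 0.
  by rewrite mulf_neq0 ?pnatr_eq0 ?gt_eqF// Fentry_gt0.
by rewrite mulf_eq0 invr_eq0 (negbTE F2) orbF sqrf_eq0 subr_eq0 => /eqP.
Qed.
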